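(* Let $T$ be an irreducible affine variety over an algebraically closed field $\Bbbk$ and let $\varphi:T\to\mathrm{Bir}(\mathbb{P}^n)$ be a morphism. Then: (a) there exists a finite stratification $T=\bigcup_{j=1}^{\ell}V_j$ by locally closed sets such that $\deg(\varphi_t)$ is constant for $t\in V_j$, for each $j=1,\dots,\ell$; (b) the function $T\to\mathbb{N}$, $t\mapsto\deg(\varphi_t)$, is lower semicontinuous, i.e. $\{t\in T:\deg(\varphi_t)\le d\}$ is closed in $T$ for all $d$.
   Context: For an irreducible variety $X$, $\mathrm{Bir}(X)$ is the group of birational maps $X\dashrightarrow X$. For a variety $T$, a pseudo-automorphism of $T\times X$ over $T$ is a birational map $\varphi:T\times X\dashrightarrow T\times X$ for which there is a dense open $U\subset T\times X$ such that: $\varphi$ is defined on $U$; $U_t:=U\cap(\{t\}\times X)$ is dense in $\{t\}\times X$ for all $t\in T$; and there is a morphism $f:U\to X$ with $\varphi|_U(t,x)=(t,f(t,x))$ and $\varphi|_{U_t}:U_t\to\{t\}\times X$ a birational morphism for every $t$. The induced map $T\to\mathrm{Bir}(X)$, $t\mapsto\varphi_t$ (also written $\varphi(t)$), is called a morphism from $T$ to $\mathrm{Bir}(X)$. The degree $\deg(f)$ of $f\in\mathrm{Bir}(\mathbb{P}^n)$ is the common degree of homogeneous polynomials $f_0,\dots,f_n\in\Bbbk[x_0,\dots,x_n]$ without nontrivial common factor such that $f=(f_0:\cdots:f_n)$. *)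

(* Defs.v *)
From mathcomp Require Import all_boot all_order all_algebra.
From mathcomp Require Import boolp classical_sets.
From mathcomp Require Import mpoly.

Set Implicit Arguments.
Unset Strict Implicit.
Unset Printing Implicit Defensive.

Import GRing.Theory.
Local Open Scope classical_set_scope.
Local Open Scope ring_scope.

(* A set of K-points described by coordinate vectors: [coords x] is the set of
   all coordinate vectors of x (a single one in affine space, a punctured line
   in projective space), and [form_deg d] is the set of forms of degree d.
   Values of forms are taken on coordinate vectors; only the vanishing of a form
   and quotients of forms of equal degree are meaningful at a point.  All
   Zariski-topological notions below are relative to subsets of such a space;
   varieties are reduced and identified with their sets of K-points. *)
Record space (K : fieldType) := Space {
  pt :> Type;
  vec : Type;
  coords : pt -> set vec;
  form : Type;
  form_deg : nat -> set form;
  feval : form -> vec -> K }.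

Section Varieties.
Variable K : fieldType.
Implicit Types A B : space K.

Definition zclosed A (C : set A) : Prop :=
  exists S : set (form A),
    (forall p, S p -> exists d, form_deg d p) /\
    C = [set x | forall p, S p -> forall v, coords x v -> feval p v = 0].

Definition closed_in A (Y C : set A) : Prop :=
  exists2 D : set A, zclosed D & C = Y `&` D.

Definition open_in A (Y U : set A) : Prop :=
  exists2 D : set A, zclosed D & U = Y `\` D.

Definition locally_closed_in A (Y V : set A) : Prop :=
  exists C U : set A, [/\ closed_in Y C, open_in Y U & V = C `&` U].

Definition dense_in A (Y U : set A) : Prop :=
  U `<=` Y /\ forall V, open_in Y V -> V !=set0 -> (V `&` U) !=set0.

Definition dense_open_in A (Y U : set A) : Prop :=
  open_in Y U /\ dense_in Y U.

Definition irreducible A (Y : set A) : Prop :=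
  Y !=set0 /\
  forall C D : set A, closed_in Y C -> closed_in Y D -> Y = C `|` D ->
    Y = C \/ Y = D.

(* Maps and functions are total in Rocq; only their values on the indicated
   subset are relevant. *)
Definition regular A (Y : set A) (g : A -> K) : Prop :=
  forall x, Y x -> exists V d a b,
    [/\ open_in Y V, V x, form_deg d a, form_deg d b &
        forall y, V y -> forall v, coords y v ->
          feval b v != 0 /\ g y = feval a v / feval b v].

Definition morphism A B (Y : set A) (Z : set B) (f : A -> B) : Prop :=
  [/\ forall x, Y x -> Z (f x),
      forall C, closed_in Z C -> closed_in Y (Y `&` f @^-1` C) &
      forall V g, open_in Z V -> regular V g ->
        regular (Y `&` f @^-1` V) (g \o f)].

Definition isomorphism A B (Y : set A) (Z : set B) (f : A -> B) : Prop :=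
  morphism Y Z f /\
  exists g : B -> A, [/\ morphism Z Y g,
    forall x, Y x -> g (f x) = x & forall z, Z z -> f (g z) = z].

Definition birational_morphism A B (Y : set A) (Z : set B) (f : A -> B) :=
  morphism Y Z f /\
  exists U V, [/\ dense_open_in Y U, dense_open_in Z V & isomorphism U V f].

(* A representative of a rational map from Y to Z: a morphism defined on a
   dense open subset of Y.  Rational maps are the classes for [rat_eq]. *)
Record rat_map A B (Y : set A) (Z : set B) := RatMap {
  rdom : set A;
  rfun :> A -> B;
  rdom_dense : dense_open_in Y rdom;
  rfun_morphism : morphism rdom Z rfun }.

Definition rat_eq A B (Y : set A) (Z : set B) (f g : rat_map Y Z) : Prop :=
  exists W, [/\ dense_open_in Y W, W `<=` rdom f `&` rdom g &
                forall x, W x -> f x = g x].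

Definition birational A B (Y : set A) (Z : set B) (f : rat_map Y Z) : Prop :=
  birational_morphism (rdom f) Z f.

Record Bir A (Y : set A) := MkBir {
  bir_map :> rat_map Y Y;
  bir_mapP : birational bir_map }.

(* The rational map (class) f is defined on U, where it is given by h. *)
Definition rat_defined A B (Y : set A) (Z : set B) (f : rat_map Y Z)
    (U : set A) (h : A -> B) : Prop :=
  exists g : rat_map Y Z, [/\ rdom g = U, rfun g = h & rat_eq f g].

End Varieties.

Section Spaces.
Variables (K : fieldType) (m n : nat).

Definition affine : space K :=
  @Space K 'rV[K]_m 'rV[K]_m (fun x => [set x])
    {mpoly K[m]} (fun _ => setT) (fun p v => p.@[v 0]).

(* Points of the n-dimensional projective space are the lines through the
   origin in K^(n+1). *)
Definition line := {L : {vspace 'rV[K]_n.+1} | \dim L == 1%N}.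

Definition hcoords (L : line) : set 'rV[K]_n.+1 :=
  [set v | v \in val L /\ v != 0].

Definition proj : space K :=
  @Space K line 'rV[K]_n.+1 hcoords
    {mpoly K[n.+1]} (fun d => [set p | p \is d.-homog]) (fun p v => p.@[v 0]).

(* The product of [affine] and [proj]; its forms are the homogeneous polynomials
   in x_0, ..., x_n with coefficients in K[t_1, ..., t_m]. *)
Definition affine_proj : space K :=
  @Space K ('rV[K]_m * line) ('rV[K]_m * 'rV[K]_n.+1)
    (fun q => [set v | v.1 = q.1 /\ hcoords q.2 v.2])
    {mpoly {mpoly K[m]}[n.+1]} (fun d => [set p | p \is d.-homog])
    (fun p v => (map_mpoly (meval (v.1 0)) p).@[v.2 0]).

End Spaces.

Section Cremona.
Variables (K : fieldType) (m n : nat).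

Local Notation A := (affine K m).
Local Notation P := (proj K n).
Local Notation AP := (affine_proj K m n).

Definition cylinder (T : set A) : set AP := [set q | T q.1].

Definition fiber (t : A) : set AP := [set q | q.1 = t].

(* [Phi] is a pseudo-automorphism of T x P^n over T, as witnessed by the open
   subset U and the morphism f : U -> P^n. *)
Definition pseudo_automorphism (T : set A)
    (Phi : rat_map (cylinder T) (cylinder T)) (U : set AP) (f : AP -> P) :=
  let h : AP -> AP := fun q => (q.1, f q) in
  [/\ birational Phi,
      dense_open_in (cylinder T) U /\ rat_defined Phi U h,
      forall t, T t -> dense_in (fiber t) (U `&` fiber t),
      morphism U [set: P] f &
      forall t, T t -> birational_morphism (U `&` fiber t) (fiber t) h].

(* [phi] is the map t |-> Phi_t induced by some pseudo-automorphism Phi; as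
   elements of [Bir] are representatives, phi t need only be equivalent to the
   rational map x |-> f (t, x).  Values of phi outside T are irrelevant. *)
Definition bir_morphism (T : set A) (phi : A -> Bir [set: P]) : Prop :=
  exists (Phi : rat_map (cylinder T) (cylinder T)) (U : set AP) (f : AP -> P),
    pseudo_automorphism Phi U f /\
    forall t, T t ->
      rat_defined (phi t) [set x : P | U (t, x)] (fun x => f (t, x)).

End Cremona.

Section Degree.
Variables (K : fieldType) (n : nat).

Definition no_common_factor (F : 'I_n.+1 -> {mpoly K[n.+1]}) : Prop :=
  forall h, (forall i, exists g, F i = g * h) -> h \is a GRing.unit.

(* f = (F_0 : ... : F_n) on a dense open subset; in particular the F_i have no
   common zero there. *)
Definition given_by (f : Bir [set: proj K n])
    (F : 'I_n.+1 -> {mpoly K[n.+1]}) : Prop :=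
  exists W, [/\ dense_open_in setT W, W `<=` rdom f &
    forall x, W x -> forall v, coords x v ->
      coords (f x) (\row_i (F i).@[v 0])].

Definition is_degree (f : Bir [set: proj K n]) (d : nat) : Prop :=
  exists F : 'I_n.+1 -> {mpoly K[n.+1]},
    [/\ forall i, F i \is d.-homog, no_common_factor F & given_by f F].

(* The d with [is_degree f d] (which exists and is unique); the default value 0
   is never used. *)
Definition deg (f : Bir [set: proj K n]) : nat := xget 0%N [set d | is_degree f d].

End Degree.

(* Main.v *)
(* The degree of a Cremona transformation g is the least degree of a nonzero
   tuple of forms F such that F(x) lies on the line g(x) for generic x: when F
   has no common factor, unique factorization in K[x_0, ..., x_n] makes every
   other such tuple a multiple of F.  Hence deg g <= d says that the linear
   system F_i G_j = F_j G_i in the coefficients of F, with F of degree d and G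
   any tuple representing g, has a nonzero solution.  Near a given t_0 a
   representing tuple G of phi_t can be chosen polynomial in t, so the absence
   of nonzero solutions is an open condition on t; this is (b).  The local tuple
   G also bounds the degree by deg G on a nonempty open set, hence on T by (b)
   and irreducibility, and (a) follows. *)
Require Import Defs.
From mathcomp Require Import all_boot all_order all_algebra.
From mathcomp Require Import boolp classical_sets.
From mathcomp Require Import mpoly.

Set Implicit Arguments.
Unset Strict Implicit.
Unset Printing Implicit Defensive.

Import GRing.Theory.
Local Open Scope classical_set_scope.
Local Open Scope ring_scope.

(** * Unique factorization *)

Definition divides (R : idomainType) (a b : R) : Prop := exists c, b = c * a.

Definition prime_elt (R : idomainType) (p : R) : Prop :=
  [/\ p != 0, p \isn't a GRing.unit &
      forall a b, divides p (a * b) -> divides p a \/ divides p b].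

Definition factors (R : idomainType) (a : R) : Prop :=
  exists u s, [/\ u \is a GRing.unit, forall p, p \in s -> prime_elt p &
                  a = u * \prod_(p <- s) p].

(** Since the factors are prime and not merely irreducible, existence alone characterizes unique
    factorization domains. *)
Definition factorial_ring (R : idomainType) : Prop :=
  forall a : R, a != 0 -> factors a.

Lemma factors_unit (R : idomainType) (u : R) :
  u \is a GRing.unit -> factors u.
Proof. by exists u, [::]; split=> //; rewrite big_nil mulr1. Qed.

Lemma factors_prime (R : idomainType) (p : R) : prime_elt p -> factors p.
Proof.
move=> pP; exists 1, [:: p]; split; first exact: unitr1.
  by move=> q; rewrite inE => /eqP ->.
by rewrite big_seq1 mul1r.
Qed.

Lemma factorsM (R : idomainType) (a b : R) :
  factors a -> factors b -> factors (a * b).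
Proof.
move=> [u [s [uU sP ->]]] [v [t [vU tP ->]]].
exists (u * v), (s ++ t); split; first by rewrite unitrM uU.
  by move=> p; rewrite mem_cat => /orP[/sP|/tP].
by rewrite big_cat mulrACA.
Qed.

(** Induction on the number of prime factors: the divisibility arguments below remove one prime at a
    time. *)
Lemma factorial_ind (R : idomainType) (P : R -> Prop) :
  factorial_ring R -> (forall u, u \is a GRing.unit -> P u) ->
  (forall p a, prime_elt p -> a != 0 -> P a -> P (p * a)) ->
  forall a, a != 0 -> P a.
Proof.
move=> facR Pu Pp a /facR[u [s [uU sP ->]]].
suff [] : u * \prod_(p <- s) p != 0 /\ P (u * \prod_(p <- s) p) by [].
elim: s sP => [_|p s IHs sP].
  rewrite big_nil mulr1; split; last exact: Pu.
  by apply: contraTneq uU => ->; rewrite unitr0.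
have [q qs|nz Ps] := IHs; first by apply: sP; rewrite inE qs orbT.
have pP : prime_elt p by apply: sP; rewrite mem_head.
rewrite big_cons mulrCA; split; last exact: Pp.
by rewrite mulf_neq0 //; case: pP.
Qed.

Lemma divides_polyC (R : idomainType) (p : R) (f : {poly R}) :
  divides p%:P f <-> forall i, divides p f`_i.
Proof.
split=> [[g ->] i|pf]; first by exists g`_i; rewrite coefMC.
have /choice[c cP] : forall i, exists c, f`_i = c * p by [].
exists (\poly_(i < size f) c i); apply/polyP=> i.
rewrite coefMC coef_poly; case: ltnP => [_|/(nth_default 0) ->].
  exact: cP.
by rewrite mul0r.
Qed.

(** Gauss's lemma. If [p] divides neither [f] nor [g], let [i] and [j] be the first indices of
    coefficients that [p] does not divide. In the coefficient of index [i + j] of [f * g], every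
    term other than the product of these two is divisible by [p]. *)
Lemma prime_polyC (R : idomainType) (p : R) : prime_elt p -> prime_elt p%:P.
Proof.
move=> [p0 pU pP]; split; rewrite ?polyC_eq0 //.
  by apply: contra pU; rewrite poly_unitE size_polyC p0 /= coefC eqxx.
move=> f g pfg.
have first_bad (h : {poly R}) : ~ divides p%:P h ->
    exists i, ~ divides p h`_i /\ forall j, (j < i)%N -> divides p h`_j.
  move=> ph; have hex : exists i, ~~ `[< divides p h`_i >].
    apply: contra_notP ph => nex; apply/divides_polyC => i.
    by apply/asboolP/negPn/negP => hi; apply: nex; exists i.
  case: (ex_minnP hex) => i /asboolPn hi imin; exists i; split=> // j ji.
  by apply/asboolP/negPn/negP => hj; move: (imin _ hj); rewrite leqNgt ji.
case: (pselect (divides p%:P f)) => [|/first_bad[i [fi fj]]]; first by left.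
case: (pselect (divides p%:P g)) => [|/first_bad[j [gj gk]]]; first by right.
exfalso; have /divides_polyC/(_ (i + j)%N) := pfg.
rewrite coefM => -[c].
have ij : (i < (i + j).+1)%N by rewrite ltnS leq_addr.
rewrite (bigD1 (Ordinal ij)) //= addKn => /(canRL (addrK _)) E.
suff /pP[] : divides p (f`_i * g`_j) by [].
rewrite E; suff [d ->] : divides p
    (\sum_(k < (i + j).+1 | k != Ordinal ij) f`_k * g`_(i + j - k)).
  by exists (c - d); rewrite mulrBl.
elim/big_ind: _ => [|x y [x' ->] [y' ->]|k].
- by exists 0; rewrite mul0r.
- by exists (x' + y'); rewrite mulrDl.
rewrite -val_eqE /= neq_ltn => /orP[/fj[d ->]|ik].
  by exists (d * g`_(i + j - k)); rewrite mulrAC.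
have [|d ->] := gk (i + j - k)%N; last by exists (f`_k * d); rewrite mulrA.
by rewrite ltn_subLR ?ltn_add2r // -ltnS ltn_ord.
Qed.

Definition primitive (R : idomainType) (f : {poly R}) : Prop :=
  forall p, prime_elt p -> ~ divides p%:P f.

Lemma primitive_part (R : idomainType) (f : {poly R}) :
  factorial_ring R -> f != 0 ->
  exists c g, [/\ c != 0, primitive g & f = c%:P * g].
Proof.
move=> facR f0.
have f0' : lead_coef f != 0 by rewrite lead_coef_eq0.
have : forall c, divides c%:P f -> divides c (lead_coef f).
  by move=> c /divides_polyC; apply.
(* [a] bounds the content of [f]; its prime factors are divided out in turn. *)
move: (lead_coef f) f0' => a a0; move: a a0 f f0.
apply: (factorial_ind facR) => [u uU|p a pP a0 IH] f f0 fa.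
  exists 1, f; split; rewrite ?oner_eq0 ?mul1r // => p [p0 pU pP] /fa[c E].
  by move: uU; rewrite E unitrM (negPf pU) andbF.
have pP' := pP; case: pP => p0 pU pP.
case: (pselect (divides p%:P f)) => [[g Ef]|npf]; last first.
  (* A constant [c] dividing [f] divides [p * a]. Since [p] does not divide [f], it does not divide
     [c] either, so [c] already divides [a]. *)
  apply: IH => // c cf; have [c' E] := fa _ cf.
  have [|[c'' Ec']|[c'' Ec]] := pP c' c.
  - by exists a; rewrite -E mulrC.
  - by exists c''; apply: (mulfI p0); rewrite E Ec' !mulrA (mulrC p).
  case: npf; case: cf => g ->; exists (g * c''%:P).
  by rewrite Ec polyCM mulrA.
have g0 : g != 0 by apply: contraNneq f0 => g0; rewrite Ef g0 mul0r.
have [c [h [c0 hP Eg]]] : exists c h, [/\ c != 0, primitive h & g = c%:P * h].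
  apply: IH => // c [h Eg]; have [|d Ed] := fa (c * p).
    by exists h; rewrite Ef Eg polyCM mulrA.
  by exists d; apply: (mulfI p0); rewrite Ed [RHS]mulrC mulrA.
exists (c * p), h; split=> //; first by rewrite mulf_neq0.
by rewrite Ef Eg polyCM mulrAC.
Qed.

(** Each prime factor of [c] stays prime in [{poly R}] and cannot divide the primitive [g], so it
    divides [q] and can be cancelled. *)
Lemma primitive_cancel (R : idomainType) (c : R) (g f q : {poly R}) :
  factorial_ring R -> primitive g -> c != 0 -> c%:P * f = q * g ->
  divides g f.
Proof.
move=> facR gP c0; move: c c0 q.
apply: (factorial_ind facR) => [u uU|p a pP a0 IH] q E.
  exists (u^-1%:P * q).
  by rewrite -mulrA -E mulrA -polyCM mulVr // mul1r.
have [p0 pU pM] := prime_polyC pP.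
have [|[q' Eq]|/(gP _ pP)//] := pM q g.
  by exists (a%:P * f); rewrite -E polyCM -mulrA mulrC.
apply: (IH q'); apply: (mulfI p0).
by rewrite mulrA -polyCM E Eq mulrAC mulrC.
Qed.

(** Descends a factorization over the fraction field to [R]: by Gauss's lemma each prime of [c]
    divides [a] or [b], and dividing by a constant preserves the degree. *)
Lemma clear_denominator (R : idomainType) (c : R) (f a b : {poly R}) :
  factorial_ring R -> c != 0 -> c%:P * f = a * b ->
  exists a' b', [/\ f = a' * b', size a' = size a & size b' = size b].
Proof.
move=> facR c0; move: c c0 a b.
apply: (factorial_ind facR) => [u uU|p c pP c0 IH] a b E.
  exists (u^-1%:P * a), b; split=> //.
    by rewrite -mulrA -E mulrA -polyCM mulVr // mul1r.
  rewrite mul_polyC size_scale // invr_eq0.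
  by apply: contraTneq uU => ->; rewrite unitr0.
have [p0 pU pM] := prime_polyC pP; have p0' : p != 0 by case: pP.
have szp (h : {poly R}) : size (h * p%:P) = size h.
  by rewrite mulrC mul_polyC size_scale.
have [|[a' Ea]|[b' Eb]] := pM a b.
- by exists (c%:P * f); rewrite -E polyCM -mulrA mulrC.
- have [|x [y [Ef sx sy]]] := IH a' b; last by exists x, y; rewrite Ea szp.
  by apply: (mulfI p0); rewrite mulrA -polyCM E Ea mulrAC mulrC.
have [|x [y [Ef sx sy]]] := IH a b'; last by exists x, y; rewrite Eb szp.
by apply: (mulfI p0); rewrite mulrA -polyCM E Eb mulrA mulrC.
Qed.

(** Let [f] divide [g * h]. The gcd of [f] and [g] over the fraction field yields a factorization of
    [f] over [R] with factors of the same degrees, so one of them is constant. Either the gcd is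
    associated to [f], which then divides [g] up to a constant, or [f] and [g] are coprime and [f]
    divides [h] up to a constant. Primitivity removes the constant. *)
Lemma irreducible_primitive_prime (R : idomainType) (f : {poly R}) :
  factorial_ring R -> primitive f -> (1 < size f)%N ->
  ~ (exists a b, [/\ f = a * b, (1 < size a)%N & (1 < size b)%N]) ->
  prime_elt f.
Proof.
move=> facR fP sf irr; have f0 : f != 0 by rewrite -size_poly_gt0 ltnW.
have dvd_cancel (g : {poly R}) : dvdp f g -> divides f g.
  move=> /Pdiv.Idomain.dvdpP[[c q] /= c0].
  by rewrite -mul_polyC; exact: primitive_cancel.
split=> //; first by rewrite poly_unitE; case: eqP sf => // ->.
move=> g h [k Ek].
have /Pdiv.Idomain.dvdpP[[c q] /= c0] := dvdp_gcdl f g.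
rewrite -mul_polyC => E.
have [a [b [Ef sa sb]]] := clear_denominator facR c0 E.
have : a * b != 0 by rewrite -Ef.
rewrite mulf_eq0 negb_or => /andP[a0 b0].
have : ~~ ((1 < size a) && (1 < size b))%N.
  by apply/negP => /andP[? ?]; apply: irr; exists a, b.
rewrite negb_and -!leqNgt => /orP[a1|b1].
  left; apply: dvd_cancel.
  apply: dvdp_trans (dvdp_gcdr f g).
  have := dvdp_size_eqp (dvdp_gcdl f g).
  rewrite -sb {1}Ef size_mul //; have -> : size a = 1%N.
    by apply/eqP; rewrite eqn_leq a1 size_poly_gt0.
  by rewrite eqxx => /esym/eqp_dvdl <-; rewrite dvdpp.
right; apply: dvd_cancel; rewrite -(@Gauss_dvdpr _ h g f).
  by rewrite Ek dvdp_mull.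
by rewrite coprimep_def -sb eqn_leq b1 size_poly_gt0.
Qed.

(** Induction on the degree. The content is factored in [R]; a nonconstant primitive part is prime
    or a product of two polynomials of smaller degree. *)
Lemma factorial_poly (R : idomainType) :
  factorial_ring R -> factorial_ring {poly R}.
Proof.
move=> facR f; have [n] := ubnP (size f); elim: n f => // n IH f sf f0.
have [c [g [c0 gP Ef]]] := primitive_part facR f0.
have g0 : g != 0 by apply: contraNneq f0 => g0; rewrite Ef g0 mulr0.
have Cf (a : R) : a != 0 -> factors a%:P.
  move: a; apply: (factorial_ind facR) => [u uU|p a pP a0 ?].
    by apply: factors_unit; rewrite rmorph_unit.
  by rewrite polyCM; apply: factorsM => //; exact/factors_prime/prime_polyC.
rewrite Ef; apply: factorsM; first exact: Cf.
have sgf : size g = size f by rewrite Ef mul_polyC size_scale.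
have [sg|sg] := leqP (size g) 1.
  by move: g0; rewrite (size1_polyC sg) polyC_eq0; exact: Cf.
case: (pselect (exists a b,
  [/\ g = a * b, (1 < size a)%N & (1 < size b)%N])) => [|irr]; last
  exact/factors_prime/irreducible_primitive_prime.
move=> [a [b [Eg sa sb]]].
have a0 : a != 0 by rewrite -size_poly_gt0 ltnW.
have b0 : b != 0 by rewrite -size_poly_gt0 ltnW.
have : (size a + size b <= n.+1)%N.
  move: sf; rewrite -sgf Eg size_mul // ltnS.
  by rewrite -subn1 leq_subLR add1n.
rewrite Eg => ab; apply: factorsM; apply: IH => //; rewrite -ltnS;
  apply: leq_trans ab.
  by rewrite -addn2 leq_add2l.
by rewrite -add2n leq_add2r.
Qed.

(** A prime factor of [a] fails to divide some [F i], hence divides [b]; cancel it and continue with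
    the remaining primes of [a]. *)
Lemma common_factor_cancel (R : idomainType) (I : Type) (F : I -> R) (a b : R) :
  factorial_ring R ->
  (forall h, (forall i, divides h (F i)) -> h \is a GRing.unit) ->
  a != 0 -> (forall i, divides a (b * F i)) -> divides a b.
Proof.
move=> facR cF a0; move: a a0 b.
apply: (factorial_ind facR) => [u uU|p a pP a0 IH] b aF.
  by exists (b / u); rewrite divrK.
have [p0 pU pM] := pP.
have [i npi] : exists i, ~ divides p (F i).
  by apply: contrapT => np; move/negP: pU; apply; apply: cF => i;
    apply: contrapT => npi; apply: np; exists i.
have [b' Eb] : divides p b.
  have [c Ec] := aF i; have [|//|//] := pM b (F i).
  by exists (c * a); rewrite Ec mulrCA mulrC.
have [|c Ec] := IH b'; last by exists c; rewrite Eb Ec mulrAC mulrA.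
move=> j; have [c Ec] := aF j; exists c; apply: (mulfI p0).
by rewrite mulrA (mulrC p) -Eb Ec mulrCA.
Qed.

(** For a nonzero [F k], the relations say that [F k] divides [G k * F i] for all [i], hence divides
    [G k]. The quotient serves for all indices. *)
Lemma proportional_multiple (R : idomainType) (I : Type) (F G : I -> R) :
  factorial_ring R -> (exists i, F i != 0) ->
  (forall h, (forall i, divides h (F i)) -> h \is a GRing.unit) ->
  (forall i j, F i * G j = F j * G i) -> exists h, forall i, G i = h * F i.
Proof.
move=> facR [k Fk] cF FG.
have [h Eh] : divides (F k) (G k).
  apply: common_factor_cancel cF Fk _ => // i.
  by exists (G i); rewrite mulrC -FG mulrC.
exists h => i; apply: (mulfI Fk).
by rewrite FG Eh mulrCA (mulrC (F i)) mulrCA.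
Qed.

Lemma factorial_iso (R S : idomainType) (f : {rmorphism R -> S})
    (g : {rmorphism S -> R}) :
  cancel f g -> cancel g f -> factorial_ring S -> factorial_ring R.
Proof.
move=> fK gK facS a a0.
have : f a != 0 by rewrite -(rmorph0 f) (can_eq fK).
move=> /facS[u [s [uU sP E]]].
exists (g u), (map g s); split; first exact: rmorph_unit.
  move=> _ /mapP[p /sP[p0 pU pM] ->]; split.
  - by rewrite -(rmorph0 g) (can_eq gK).
  - by apply: contra pU => /(rmorph_unit f); rewrite gK.
  move=> x y [c Ec]; have [|[d Ed]|[d Ed]] := pM (f x) (f y).
  + by exists (f c); rewrite -rmorphM Ec rmorphM gK.
  + by left; exists (g d); rewrite -rmorphM -Ed fK.
  + by right; exists (g d); rewrite -rmorphM -Ed fK.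
by rewrite -[a]fK E rmorphM rmorph_prod big_map.
Qed.

(** * Multivariate polynomials as univariate ones in the last variable, and their factoriality *)

Lemma mpoly_rmorph_ext (n : nat) (R S : comNzRingType)
    (f g : {rmorphism {mpoly R[n]} -> S}) :
  (forall c, f c%:MP = g c%:MP) -> (forall i, f 'X_i = g 'X_i) -> f =1 g.
Proof.
move=> fgC fgX p; rewrite (mpolyE p) !rmorph_sum; apply: eq_bigr => m _ /=.
rewrite -mul_mpolyC !rmorphM fgC; congr (_ * _).
rewrite mpolyXE_id !rmorph_prod; apply: eq_bigr => i _ /=.
by rewrite !rmorphXn fgX.
Qed.

Section MuniIso.
Variables (n : nat) (R : comNzRingType).

Lemma muniXmax : muni ('X_ord_max : {mpoly R[n.+1]}) = 'X.
Proof.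
rewrite /muni mmapX mmap1U; case: splitP => //= j E.
by have := ltn_ord j; rewrite -E ltnn.
Qed.

Lemma muniXwiden (i : 'I_n) :
  muni ('X_(widen_ord (leqnSn n) i) : {mpoly R[n.+1]}) = ('X_i)%:P.
Proof.
rewrite /muni mmapX mmap1U; case: splitP => /= j E.
  by congr ('X__)%:P; apply/val_inj.
by have := ltn_ord i; rewrite E ltnNge addnC leq_addl.
Qed.

Lemma ordS_cases (P : 'I_n.+1 -> Prop) :
  (forall i, P (widen_ord (leqnSn n) i)) -> P ord_max -> forall i, P i.
Proof.
move=> Pw Pm i; case: (ltnP i n) => [lin|nli].
  by have -> : i = widen_ord (leqnSn n) (Ordinal lin) by exact/val_inj.
suff -> : i = ord_max by [].
by apply/val_inj/eqP; rewrite /= eqn_leq nli -ltnS ltn_ord.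
Qed.

Lemma mwidenXU (i : 'I_n) :
  mwiden ('X_i : {mpoly R[n]}) = 'X_(widen_ord (leqnSn n) i).
Proof. by rewrite mwidenX mnmwiden1. Qed.

Lemma muni_mwiden (c : {mpoly R[n]}) : muni (mwiden c) = c%:P.
Proof.
apply: (mpoly_rmorph_ext (f := @muni n R \o @mwiden n R) (g := polyC))
  => [a|i] /=.
  by rewrite mwidenC muniC.
by rewrite mwidenXU muniXwiden.
Qed.

Let unmuni : {rmorphism {poly {mpoly R[n]}} -> {mpoly R[n.+1]}} :=
  horner_eval 'X_ord_max \o @mpwiden n R.

Lemma muniK : cancel (@muni n R) unmuni.
Proof.
apply: (mpoly_rmorph_ext (f := unmuni \o @muni n R) (g := idfun)) => [c|] /=.
  by rewrite muniC /= mpwidenC /horner_eval hornerC mwidenC.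
apply: ordS_cases => [i|].
  by rewrite muniXwiden /= mpwidenC /horner_eval hornerC mwidenXU.
by rewrite muniXmax /= mpwidenX /horner_eval hornerX.
Qed.

Lemma unmuniK : cancel unmuni (@muni n R).
Proof.
move=> p; elim/poly_ind: p => [|p c IH]; first by rewrite !rmorph0.
rewrite [unmuni _]rmorphD [unmuni (p * _)]rmorphM muniD muniM IH.
rewrite /= mpwidenX mpwidenC /horner_eval hornerX hornerC muniXmax.
by rewrite muni_mwiden.
Qed.

End MuniIso.

Lemma mpoly0_const (R : nzRingType) (p : {mpoly R[0]}) : p = (p@_0)%:MP.
Proof.
apply/mpolyP => m; have -> : m = 0%MM by apply/mnmP; case.
by rewrite mcoeffC eqxx mulr1.
Qed.

Lemma factorial_mpoly (K : fieldType) (n : nat) : factorial_ring {mpoly K[n]}.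
Proof.
elim: n => [p p0|n IH].
  apply: factors_unit; rewrite (mpoly0_const p) rmorph_unit // unitfE.
  by apply: contraNneq p0 => p0; rewrite (mpoly0_const p) p0 mpolyC0.
exact: (factorial_iso (@muniK n K) (@unmuniK n K) (factorial_poly IH)).
Qed.

(** * Points at which a nonzero polynomial does not vanish *)

Lemma meval_muni (R : comNzRingType) (n : nat) (v : 'I_n.+1 -> R)
    (p : {mpoly R[n.+1]}) :
  p.@[v] =
  (map_poly (meval (v \o widen_ord (leqnSn n))) (muni p)).[v ord_max].
Proof.
apply: (mpoly_rmorph_ext (f := meval v) (g := horner_eval (v ord_max) \o
  map_poly (meval (v \o widen_ord (leqnSn n))) \o @muni n R)) => [c|] /=.
  by rewrite mevalC muniC map_polyC /horner_eval hornerC /= mevalC.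
apply: ordS_cases => [i|]; rewrite mevalXU.
  by rewrite muniXwiden map_polyC /horner_eval hornerC /= mevalXU.
by rewrite muniXmax map_polyX /horner_eval hornerX.
Qed.

(** By induction the leading coefficient in the last variable is nonzero at some [w]. The resulting
    univariate polynomial is nonzero, so it has a nonroot because an algebraically closed field is
    infinite. *)
Lemma mpoly_nonroot (K : closedFieldType) (n : nat) (p : {mpoly K[n]}) :
  p != 0 -> exists v : 'I_n -> K, p.@[v] != 0.
Proof.
elim: n p => [|n IH] p p0.
  exists (fun=> 0); rewrite (mpoly0_const p) mevalC.
  by apply: contraNneq p0 => p0; rewrite (mpoly0_const p) p0 mpolyC0.
have : muni p != 0 by rewrite -(muni0 n K) (can_eq (@muniK n K)).
rewrite -lead_coef_eq0 => /IH[w w0].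
have /closed_nonrootP[x] : map_poly (meval w) (muni p) != 0.
  apply/eqP => /(congr1 (fun q : {poly K} => q`_(size (muni p)).-1)).
  by rewrite coef_map coef0; apply/eqP.
rewrite rootE => px.
exists (fun i => if unlift ord_max i is Some j then w j else x).
rewrite meval_muni unlift_none (eq_map_poly (g := meval w)) // => q.
apply: meval_eq => i /=.
suff -> : widen_ord (leqnSn n) i = lift ord_max i by rewrite liftK.
by apply/val_inj; rewrite /= /bump leqNgt ltn_ord.
Qed.

(** A nonroot of [p * 'X_0] has a nonzero coordinate, so it is a coordinate vector of a projective
    point. *)
Lemma mpoly_nonroot_neq0 (K : closedFieldType) (n : nat) (p : {mpoly K[n.+1]}) :
  p != 0 -> exists2 v : 'rV[K]_n.+1, v != 0 & p.@[v 0] != 0.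
Proof.
move=> p0; have [] := @mpoly_nonroot K _ (p * 'X_0).
  by rewrite mulf_neq0 // -msize_poly_eq0 msizeX.
move=> v; rewrite mevalM mevalXU mulf_eq0 negb_or => /andP[pv v0].
exists (\row_i v i); last by rewrite (meval_eq (v2 := v)) // => i; rewrite mxE.
by apply: contraNneq v0 => /rowP/(_ 0); rewrite !mxE => ->.
Qed.

(** * Degrees of rational maps *)

(** One of the forms defining [C] is nonzero at [x]. Such principal neighbourhoods turn topological
    conditions into nonvanishing of polynomials. *)
Lemma closed_in_avoid (K : fieldType) (X : Defs.space K) (Y C : set X) (x : X) :
  closed_in Y C -> Y x -> ~ C x -> exists p, [/\ exists d, form_deg d p,
    exists2 v, coords x v & feval p v != 0 &
    forall y v, Y y -> coords y v -> feval p v != 0 -> ~ C y].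
Proof.
move=> [D [S [Sh ->]] ->] Yx nCx.
have [p [Sp [v [vx pv]]]] : exists p,
    S p /\ exists v, coords x v /\ feval p v != 0.
  apply: contrapT => np; apply: nCx; split=> // p Sp v vx; apply/eqP.
  by apply: contrapT => /negP pv; apply: np; exists p; split=> //; exists v.
exists p; split; [exact: Sh|by exists v|].
by move=> y w Yy wy pw [_ /(_ p Sp w wy)/eqP]; rewrite (negPf pw).
Qed.

Lemma open_in_principal (K : fieldType) (X : Defs.space K) (Y V : set X)
    (x : X) :
  open_in Y V -> V x -> exists p, [/\ exists d, form_deg d p,
    exists2 v, coords x v & feval p v != 0 &
    forall y v, Y y -> coords y v -> feval p v != 0 -> V y].
Proof.
move=> [D Dc ->] [Yx nDx].
have [|[_ //]|p [pd pv pD]] := @closed_in_avoid K X Y (Y `&` D) x _ Yx.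
  by exists D.
exists p; split=> // y v Yy vy pvy; split=> // Dy.
by apply: (pD _ _ Yy vy pvy).
Qed.

Lemma zclosed_set0 (K : fieldType) (X : Defs.space K) (p : Defs.form X) d :
  form_deg d p -> (forall x : X, exists2 v, coords x v & feval p v != 0) ->
  zclosed (@set0 X).
Proof.
move=> pd pv; exists [set p]; split=> [_ ->|]; first by exists d.
apply/seteqP; split=> x //= /(_ p erefl); have [v vx /eqP pv0] := pv x.
by move=> /(_ v vx).
Qed.

(** Checked on the monomials of [q]. It serves to pass to homogeneous components of cofactors that
    are not known to be forms. *)
Lemma pihomogM (R : comNzRingType) (n d k : nat) (p q : {mpoly R[n]}) :
  p \is d.-homog -> pihomog mdeg (d + k) (p * q) = p * pihomog mdeg k q.
Proof.
move=> pd; rewrite (mpolyE q) mulr_sumr !raddf_sum mulr_sumr.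
apply: eq_bigr => m _ /=; rewrite -scalerAr !linearZ /= -scalerAr.
congr (_ *: _).
have Xm : ('X_[m] : {mpoly R[n]}) \is (mdeg m).-homog by rewrite dhomogX.
rewrite pihomogX; case: eqP => [mk|/eqP mk].
  by rewrite pihomog_dE // -mk dhomogM.
by rewrite mulr0 (pihomog_ne0 _ (dhomogM pd Xm)) // eqn_add2l.
Qed.

Lemma meval_scale (R : comNzRingType) (n d : nat) (p : {mpoly R[n]}) (c : R)
    (v : 'rV[R]_n) :
  p \is d.-homog -> p.@[(c *: v) 0] = c ^+ d * p.@[v 0].
Proof.
move=> /dhomogP pd; rewrite !mevalE mulr_sumr big_seq [RHS]big_seq.
apply: eq_bigr => m /pd /= <-; rewrite mulrCA; congr (_ * _).
rewrite mdegE -prodrXr -big_split; apply: eq_bigr => i _.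
by rewrite mxE exprMn.
Qed.

(** * Coordinate vectors of projective points *)

Section Lines.
Variables (K : fieldType) (n : nat).
Implicit Types (x : line K n) (u v w : 'rV[K]_n.+1).

Lemma hcoords_ex v : v != 0 -> exists x, hcoords x v.
Proof.
move=> v0; have L : \dim <[v]> == 1%N by rewrite dim_vline v0.
by exists (exist _ <[v]>%VS L); split=> //=; exact: memv_line.
Qed.

Lemma vpick_hcoords x : hcoords x (vpick (val x)).
Proof.
by split; [exact: memv_pick|rewrite vpick0 -dimv_eq0 (eqP (valP x))].
Qed.

Lemma line_coords x : exists v, hcoords x v.
Proof. by exists (vpick (val x)); exact: vpick_hcoords. Qed.

Lemma hcoords_scale x v w : hcoords x v -> w \in val x -> exists c, w = c *: v.
Proof.
move=> [vx v0] wx; apply/vlineP.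
suff <- : val x = <[v]>%VS by [].
by apply/esym/eqP; rewrite eqEdim -memvE vx dim_vline v0 (eqP (valP x)).
Qed.

Lemma line_cross x u w i j : u \in val x -> w \in val x ->
  u 0 i * w 0 j = u 0 j * w 0 i.
Proof.
have [v vx] := line_coords x.
move=> /(hcoords_scale vx)[a ->] /(hcoords_scale vx)[b ->].
by rewrite !mxE mulrACA (mulrC (v 0 i)) mulrACA.
Qed.

Lemma line_mem x u w i : u \in val x -> u 0 i != 0 ->
  (forall j, u 0 i * w 0 j = u 0 j * w 0 i) -> w \in val x.
Proof.
move=> ux ui uw; suff -> : w = (w 0 i / u 0 i) *: u by exact: memvZ.
apply/rowP => j; rewrite !mxE; apply: (mulfI ui).
by rewrite uw mulrA mulrCA divff // mulr1 mulrC.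
Qed.

Lemma zclosed_set0_proj : zclosed (@set0 (proj K n)).
Proof.
apply: (zclosed_set0 (X := proj K n) (p := 1) (d := 0%N)) => [|x].
  exact: dhomog1.
by exists (vpick (val x)); [exact: vpick_hcoords|rewrite /= meval1 oner_eq0].
Qed.

Lemma zclosed_set0_affine (m : nat) : zclosed (@set0 (affine K m)).
Proof.
apply: (zclosed_set0 (X := affine K m) (p := 1) (d := 0%N)) => // x.
by exists x; rewrite //= meval1 oner_eq0.
Qed.

Lemma zclosed_set0_affine_proj (m : nat) : zclosed (@set0 (affine_proj K m n)).
Proof.
apply: (zclosed_set0 (X := affine_proj K m n) (p := 1) (d := 0%N)) => [|q].
  exact: dhomog1.
have [v vq] := line_coords q.2; exists (q.1, v); first by [].
by rewrite /= !rmorph1 oner_eq0.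
Qed.

End Lines.

(** * Tuples of forms representing a rational map, and its degree *)

Section Representation.
Variables (K : closedFieldType) (n : nat).
Local Notation P := (proj K n).
Local Notation tuple := ('I_n.+1 -> {mpoly K[n.+1]}).
Implicit Types (f g : P -> P) (F G : tuple) (b : {mpoly K[n.+1]}) (W : set P).

Lemma form_nonzero b e (x : P) v w : b \is e.-homog -> hcoords x v ->
  hcoords x w -> b.@[v 0] != 0 -> b.@[w 0] != 0.
Proof.
move=> be vx [wx w0] bv; have [c Ew] := hcoords_scale vx wx.
rewrite Ew (meval_scale _ _ be) mulf_neq0 // expf_neq0 //.
by apply: contraNneq w0 => c0; rewrite Ew c0 scale0r.
Qed.

Lemma open_contains_form W : open_in setT W -> W !=set0 ->
  exists b e, [/\ b != 0, b \is e.-homog &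
    forall (x : P) v, hcoords x v -> b.@[v 0] != 0 -> W x].
Proof.
move=> Wo [x Wx]; have [b [[e be] [v _ bv] bW]] := open_in_principal Wo Wx.
exists b, e; split=> // [|y w wy]; last exact: bW.
by apply: contraNneq bv => ->; rewrite /= meval0.
Qed.

(** Dense because every nonempty open set contains the nonvanishing locus of some nonzero form [p],
    and [p * b] is nonzero at some point. *)
Lemma form_dense_open b e : b != 0 -> b \is e.-homog ->
  dense_open_in setT [set x : P | forall v, hcoords x v -> b.@[v 0] != 0].
Proof.
move=> b0 be; split.
  exists [set x : P | forall v, hcoords x v -> b.@[v 0] = 0].
    exists [set b]; split=> [_ ->|]; first by exists e.
    by apply/seteqP; split=> x /= bx => [p ->|v vx]; [exact: bx | exact: bx].
  apply/seteqP; split=> x /=.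
    move=> bx; split=> // bx'; have [v vx] := line_coords x.
    by move/eqP: (bx _ vx); rewrite bx'.
  move=> [_ nbx] w wx; apply: contrapT => /negP; rewrite negbK => bw.
  apply: nbx => v vx; apply/eqP/negPn/negP => bv.
  by move: (form_nonzero be vx wx bv); rewrite bw.
split=> // V Vo V0; have [p [d [p0 pd pV]]] := open_contains_form Vo V0.
have [v v0] := mpoly_nonroot_neq0 (mulf_neq0 p0 b0).
rewrite mevalM mulf_eq0 negb_or => /andP[pv bv].
have [x vx] := hcoords_ex v0; exists x; split; first exact: pV vx pv.
by move=> w wx; exact: form_nonzero be vx wx bv.
Qed.

Lemma dense_open_form W : dense_open_in setT W ->
  exists b e, [/\ b != 0, b \is e.-homog &
    forall (x : P) v, hcoords x v -> b.@[v 0] != 0 -> W x].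
Proof.
move=> [Wo [_ Wd]]; apply: open_contains_form => //.
have [x xP] : exists x : P, True.
  have /mpoly_nonroot_neq0[v v0 _] := oner_neq0 {mpoly K[n.+1]}.
  by have [x] := hcoords_ex v0; exists x.
have [||y [_ Wy]] := Wd setT; [|by exists x|by exists y].
by exists set0; [exact: zclosed_set0_proj|rewrite setD0].
Qed.

(** Unlike in [given_by], the value of [F] at a point of the dense open set [b <> 0] may be the zero
    vector. Common factors are thus allowed, and the condition is linear in [F]. *)
Definition represents f F : Prop :=
  exists b, [/\ b != 0, exists e, b \is e.-homog &
    forall (x : P) v, hcoords x v -> b.@[v 0] != 0 ->
      \row_i (F i).@[v 0] \in val (f x)].

Lemma represents_eq_on f g F W : dense_open_in setT W ->
  (forall x, W x -> f x = g x) -> represents f F -> represents g F.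
Proof.
move=> /dense_open_form[c [d [c0 cd cW]]] fg [b [b0 [e be] bF]].
exists (b * c); split; [exact: mulf_neq0|by exists (e + d)%N; exact: dhomogM|].
move=> x v vx; rewrite mevalM mulf_eq0 negb_or => /andP[bv cv].
by rewrite -fg; [exact: bF|exact: cW vx cv].
Qed.

(** Two vectors on one line have vanishing 2 by 2 minors. Here this holds wherever [b * c] is
    nonzero, so the minors vanish as polynomials. *)
Lemma represents_proportional f F G : represents f F -> represents f G ->
  forall i j, F i * G j = F j * G i.
Proof.
move=> [b [b0 _ bF]] [c [c0 _ cG]] i j; apply/eqP; rewrite -subr_eq0.
apply/negPn/negP => FG0.
have [v v0] := mpoly_nonroot_neq0 (mulf_neq0 (mulf_neq0 b0 c0) FG0).
rewrite !mevalM !mulf_eq0 !negb_or -andbA => /and3P[bv cv].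
have [x vx] := hcoords_ex v0.
have := line_cross i j (bF _ _ vx bv) (cG _ _ vx cv).
by rewrite !mxE mevalB !mevalM => ->; rewrite subrr eqxx.
Qed.

(** Where [b * F i] is nonzero, [F] spans the line and the relations put [G] on it; homogeneity of
    [F i] makes [b * F i] a form. *)
Lemma proportional_represents f F G d i : represents f F -> F i != 0 ->
  F i \is d.-homog -> (forall j, F i * G j = F j * G i) -> represents f G.
Proof.
move=> [b [b0 [e be] bF]] Fi Fd FG; exists (b * F i); split.
- exact: mulf_neq0.
- by exists (e + d)%N; exact: dhomogM.
move=> x v vx; rewrite mevalM mulf_eq0 negb_or => /andP[bv Fv].
apply: line_mem (bF x v vx bv) _ _; first by rewrite mxE; exact: Fv.
by move=> j; rewrite !mxE -!mevalM FG.
Qed.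

Definition represented_in_degree f d : Prop :=
  exists F,
    [/\ forall i, F i \is d.-homog, exists i, F i != 0 & represents f F].

Lemma represented_in_degree_leq f d e : (d <= e)%N ->
  represented_in_degree f d -> represented_in_degree f e.
Proof.
move=> de [F [Fd [i Fi] Ff]]; pose Y : {mpoly K[n.+1]} := 'X_0 ^+ (e - d).
have Y0 : Y != 0 by rewrite expf_neq0 // -msize_poly_eq0 msizeX.
exists (fun j => Y * F j); split.
- move=> j; rewrite -(subnK de); apply: dhomogM => //.
  rewrite -[(e - d)%N]mul1n; apply: dhomogMn.
  by rewrite dhomogX /= mdeg1.
- by exists i; rewrite mulf_neq0.
apply: proportional_represents Ff Fi (Fd i) _ => j.
by rewrite mulrCA (mulrC (F i)) mulrCA mulrC.
Qed.

(** Any other nonzero representing tuple is a multiple [h * F], so its degree is at least that of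
    [F]. Degrees are compared through [msize], which exceeds the degree of a nonzero form by one. *)
Lemma is_degree_minimal (f : Bir [set: P]) d : is_degree f d ->
  represented_in_degree f d /\
  forall e, represented_in_degree f e -> (d <= e)%N.
Proof.
move=> [F [Fd Fcf [W [Wd _ WF]]]].
have [b [e [b0 be bW]]] := dense_open_form Wd.
have Ff : represents f F.
  exists b; split=> // [|x v vx bv]; first by exists e.
  by case: (WF x (bW _ _ vx bv) v vx).
have Fnz : exists i, F i != 0.
  have [v v0 bv] := mpoly_nonroot_neq0 b0; have [x vx] := hcoords_ex v0.
  have [_ Fv] := WF x (bW _ _ vx bv) v vx.
  apply: contrapT => F0; move/negP: Fv; apply.
  apply/eqP/rowP => i; rewrite !mxE.
  suff -> : F i = 0 by rewrite meval0.
  by apply/eqP/negPn/negP => Fi; apply: F0; exists i.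
split=> [|k [G [Gk [j Gj] Gf]]]; first by exists F.
have [h Gh] := proportional_multiple (@factorial_mpoly K n.+1) Fnz Fcf
  (represents_proportional Ff Gf).
have /andP[h0 Fj] : (h != 0) && (F j != 0) by rewrite -negb_or -mulf_eq0 -Gh.
rewrite -ltnS.
have sz (p : {mpoly K[n.+1]}) l : p != 0 -> p \is l.-homog -> msize p = l.+1.
  move=> p0 pa; rewrite (mpolySpred _ p0); congr _.+1.
  exact: dhomog_uniq p0 (dhomog_msize pa) pa.
rewrite -(sz _ _ Fj (Fd j)) -(sz _ _ Gj (Gk j)) Gh msizeM //.
by rewrite (mpolySpred _ h0) addSn leq_addl.
Qed.

(** A representing tuple [F] of least degree [d] has no common factor. If [F = g * h], a nonzero
    homogeneous component of [g] of degree [k] is still proportional to [F], so it represents [f]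
    and [d <= k]. As [k] is at most the degree of some [g i], the factor [h] is constant. *)
Lemma is_degree_ex (f : Bir [set: P]) e : represented_in_degree f e ->
  exists d, is_degree f d.
Proof.
move=> fe; have hex : exists d, `[< represented_in_degree f d >].
  by exists e; apply/asboolP.
case: (ex_minnP hex) => d /asboolP[F [Fd [i Fi] Ff]] dmin.
exists d, F; split=> //.
  move=> h hF; have [g Eg] := choice hF.
  have /andP[gi h0] : (g i != 0) && (h != 0) by rewrite -negb_or -mulf_eq0 -Eg.
  have [k kg gk] : exists2 k, (k < msize (g i))%N & pihomog mdeg k (g i) != 0.
    apply: contrapT => gk0; move/negP: gi; apply; apply/eqP.
    rewrite (pihomog_partitionE (mf := mdeg) (k := msize (g i)) (p := g i)) //.
    apply: big1 => k _; apply/eqP/negPn/negP => gk; apply: gk0.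
    by exists k.
  have dk : (d <= k)%N.
    apply/dmin/asboolP; exists (fun j => pihomog mdeg k (g j)); split.
    - by move=> j; exact: pihomogP.
    - by exists i.
    apply: proportional_represents Ff Fi (Fd i) _ => j.
    by rewrite -!(pihomogM _ _ (Fd _)) !Eg mulrAC (mulrC (g i)) mulrAC.
  have Fs : msize (F i) = d.+1.
    rewrite (mpolySpred _ Fi); congr _.+1.
    exact: dhomog_uniq Fi (dhomog_msize (Fd i)) (Fd i).
  have : (msize h <= 1)%N.
    move: Fs; rewrite Eg msizeM // (mpolySpred _ h0) addnS /= => E.
    have : (msize (g i) + (msize h).-1 <= msize (g i) + 0)%N.
      by rewrite E addn0 (leq_ltn_trans dk kg).
    by rewrite leq_add2l.
  move=> /msize1_polyC Eh; rewrite Eh rmorph_unit // unitfE.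
  by apply: contraNneq h0 => h0; rewrite Eh h0 mpolyC0.
have [c [k [c0 ck cdom]]] := dense_open_form (rdom_dense f).
have [b [b0 [l bl] bF]] := Ff.
(* The three factors ensure that [F] lands on the line [f x], that [x] is in the domain of [f], and
   that the value of [F] is not the zero vector. *)
exists [set x : P | forall v, hcoords x v -> (b * c * F i).@[v 0] != 0]; split.
- apply: form_dense_open; rewrite ?mulf_neq0 //.
  exact: dhomogM (dhomogM bl ck) (Fd i).
- move=> x /= Hx; have [v vx] := line_coords x; apply: (cdom _ _ vx).
  by have := Hx v vx; rewrite !mevalM !mulf_eq0 !negb_or -andbA => /and3P[].
move=> x Hx v vx; have := Hx v vx.
rewrite !mevalM !mulf_eq0 !negb_or -andbA => /and3P[bv _ Fv].
split; first exact: bF.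
by apply: contraNneq Fv => /rowP/(_ i); rewrite !mxE => ->.
Qed.

(** The hypothesis guarantees that [deg f] is a genuine degree and not the default value of [xget].
    One direction multiplies by a power of ['X_0], the other is minimality. *)
Lemma deg_leq (f : Bir [set: P]) d e : represented_in_degree f e ->
  (deg f <= d)%N <-> represented_in_degree f d.
Proof.
move=> /is_degree_ex/(xgetPex 0%N)/is_degree_minimal[fdeg dmin].
split=> [|/dmin//]; rewrite /deg => le_d.
exact: represented_in_degree_leq fdeg.
Qed.

End Representation.

(** * Families of rational maps *)

Section Specialization.
Variables (K : fieldType) (m n : nat).
Implicit Types (p : {mpoly {mpoly K[m]}[n.+1]}) (t : 'rV[K]_m).

Definition spec t : {rmorphism {mpoly {mpoly K[m]}[n.+1]} -> {mpoly K[n.+1]}} :=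
  map_mpoly (meval (t 0)).

Lemma spec_homog t p d : p \is d.-homog -> spec t p \is d.-homog.
Proof.
move=> /dhomogP pd; apply/dhomogP => mm; rewrite mcoeff_msupp mcoeff_map_mpoly.
move=> pm; apply: pd; rewrite mcoeff_msupp.
by apply: contraNneq pm => E; rewrite E; apply/eqP/meval0.
Qed.

(** Fixing the projective variables leaves a polynomial in the parameter, whose vanishing is a
    closed condition on [T]. *)
Definition eval_second (v : 'I_n.+1 -> K) p : {mpoly K[m]} :=
  p.@[fun i => (v i)%:MP].

Lemma eval_secondE t v p : (eval_second v p).@[t 0] = (spec t p).@[v].
Proof.
apply: (mpoly_rmorph_ext (f := meval (t 0) \o meval (fun i => (v i)%:MP))
  (g := meval v \o spec t)) => [c|i] /=.
  by rewrite mevalC /spec map_mpolyC /= mevalC.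
by rewrite mevalXU mevalC /spec map_mpolyX mevalXU.
Qed.

End Specialization.
Arguments spec {K m n} t : simpl never.

Lemma dhomog_prod_sum (R : comNzRingType) (n : nat) (I : finType) (P : pred I)
    (b : I -> {mpoly R[n]}) (d : I -> nat) :
  (forall i, b i \is (d i).-homog) ->
  \prod_(i | P i) b i \is (\sum_(i | P i) d i)%N.-homog.
Proof.
move=> bd; elim/big_rec2: _ => [|i e p _ pe]; first exact: dhomog1.
exact: dhomogM.
Qed.

(** * Local expression of a family of maps by forms *)

Section LocalRepresentation.
Variables (K : fieldType) (m n : nat).
Local Notation A := (affine K m).
Local Notation P := (proj K n).
Local Notation AP := (affine_proj K m n).
Local Notation family := {mpoly {mpoly K[m]}[n.+1]}.

(** An affine coordinate on the chart where the [i]-th coordinate is nonzero; there it does not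
    depend on the vector picked on the line. *)
Definition ratio (i j : 'I_n.+1) (y : P) : K :=
  vpick (val y) 0 j / vpick (val y) 0 i.

Definition hyperplane (i : 'I_n.+1) : set P :=
  [set y | forall w, hcoords y w -> w 0 i = 0].

Lemma hyperplane_closed i : zclosed (hyperplane i).
Proof.
exists [set 'X_i]; split=> [_ ->|].
  by exists 1%N; rewrite /= dhomogX /= mdeg1.
apply/seteqP; split=> y /= yi => [_ -> w wy|w wy]; first by rewrite mevalXU yi.
by have := yi _ erefl w wy; rewrite mevalXU.
Qed.

Lemma not_hyperplane i (y : P) w :
  ~ hyperplane i y -> hcoords y w -> w 0 i != 0.
Proof.
move=> ny wy; apply/negP => /eqP wi; apply: ny => u [uy _].
by have [c ->] := hcoords_scale wy uy; rewrite mxE wi mulr0.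
Qed.

Lemma ratio_regular i j : regular (setT `\` hyperplane i) (ratio i j).
Proof.
move=> y [_ ny]; exists (setT `\` hyperplane i), 1%N, 'X_j, 'X_i; split=> //.
- by exists set0; [exact: zclosed_set0_proj|rewrite setD0].
- by rewrite /= dhomogX /= mdeg1.
- by rewrite /= dhomogX /= mdeg1.
move=> z [_ nz] v vz; rewrite /= !mevalXU.
have vi := not_hyperplane nz vz; split=> //; apply: (mulIf vi).
have [_ v0] := vz; have wi := not_hyperplane nz (vpick_hcoords z).
rewrite divfK // /ratio mulrAC; apply: (mulIf wi); rewrite divfK //.
have [vz' _] := vz; have [wz' _] := vpick_hcoords z.
by rewrite (line_cross j i wz' vz') mulrC.
Qed.

(** In a chart around [f (t0, x0)] the affine coordinates of [f] are regular functions, that is,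
    quotients of forms near [(t0, x0)]. Clearing denominators gives the tuple [F]. *)
Lemma local_representation (T : set A) (U : set AP) (f : AP -> P) t0 x0 :
  open_in (cylinder T) U -> morphism U [set: P] f -> U (t0, x0) ->
  exists (b : family) (F : 'I_n.+1 -> family) d,
  [/\ exists e, b \is e.-homog, forall i, F i \is d.-homog, spec t0 b != 0 &
    forall t x v, T t -> hcoords x v -> (spec t b).@[v 0] != 0 ->
      U (t, x) /\ hcoords (f (t, x)) (\row_i (spec t (F i)).@[v 0])].
Proof.
move=> Uo [_ fC freg] Ux0.
have [i nyi] : exists i, ~ hyperplane i (f (t0, x0)).
  apply: contrapT => ny; have [_ /negP] := vpick_hcoords (f (t0, x0)); apply.
  apply/eqP/rowP => i; rewrite mxE; apply/eqP/negPn/negP => wi.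
  apply: ny; exists i.
  by move=> /(_ _ (vpick_hcoords _))/eqP; rewrite (negPf wi).
pose V := setT `\` hyperplane i.
have Vo : open_in setT V.
  by exists (hyperplane i); first exact: hyperplane_closed.
pose V' := U `&` f @^-1` V.
have V'x0 : V' (t0, x0) by split.
have nz (p : family) v : feval (s := AP) p v != 0 -> spec v.1 p != 0.
  apply: contraNneq => p0.
  by rewrite /= -[map_mpoly _ _]/(spec v.1 p) p0 meval0.
(* [r j] packs [(p, a, c, d)]: on the neighbourhood [p <> 0] of the base point, the [j]-th affine
   coordinate of [f] is [a / c] with [a] and [c] forms of degree [d]. *)
have /choice[r rP] : forall j, exists r : family * family * family * nat,
    [/\ exists e, r.1.1.1 \is e.-homog, spec t0 r.1.1.1 != 0,
      r.1.1.2 \is (r.2).-homog, r.1.2 \is (r.2).-homog &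
      forall q v, V' q -> coords q v -> feval (s := AP) r.1.1.1 v != 0 ->
        feval (s := AP) r.1.2 v != 0 /\
        ratio i j (f q) = feval (s := AP) r.1.1.2 v / feval (s := AP) r.1.2 v].
  move=> j; have [N [d [a [c [No Nx0 ad cd Nac]]]]] :=
    freg V (ratio i j) Vo (@ratio_regular i j) _ V'x0.
  have [p [pd [v [v1 _] pv] pN]] := open_in_principal No Nx0.
  exists (p, a, c, d); split=> //=; first by have := nz _ _ pv; rewrite v1.
  by move=> q w V'q wq pw; apply: Nac => //; exact: pN V'q wq pw.
have [pU [pUd [vU [vU1 _] pUv] pUU]] := open_in_principal Uo Ux0.
have [|||pV [pVd [vV [vV1 _] pVv] pVV]] :=
    @closed_in_avoid K AP U (U `&` f @^-1` hyperplane i) (t0, x0) => //.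
- by apply: fC; exists (hyperplane i); [exact: hyperplane_closed|rewrite setTI].
- by case.
(* The first form confines [(t, x)] to [U], to the preimage of the chart and to all the
   neighbourhoods of [r]. Each [F j] is the [j]-th quotient times the product of all denominators,
   so the degrees agree. *)
exists (pU * pV * \prod_j (r j).1.1.1),
  (fun j => (r j).1.1.2 * \prod_(k | k != j) (r k).1.2), (\sum_j (r j).2)%N.
split.
- have /choice[e eP] : forall j, exists e, (r j).1.1.1 \is e.-homog.
    by move=> j; case: (rP j).
  have [eU eUP] := pUd; have [eV eVP] := pVd.
  exists (eU + eV + \sum_j e j)%N.
  by have := dhomogM (dhomogM eUP eVP) (dhomog_prod_sum xpredT eP).
- move=> j; rewrite /= [X in X.-homog](bigD1 j) //=; apply: dhomogM.
    by case: (rP j).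
  by apply: dhomog_prod_sum => k; case: (rP k).
- rewrite !rmorphM rmorph_prod /= !mulf_neq0 //.
  + by have := nz _ _ pUv; rewrite vU1.
  + by have := nz _ _ pVv; rewrite vV1.
  by apply/prodf_neq0 => j _; case: (rP j).
move=> t x v Tt vx; rewrite !rmorphM !rmorph_prod /=.
rewrite !mulf_eq0 !negb_or -andbA => /and3P[pUt pVt /prodf_neq0 pt].
have cq : coords ((t, x) : AP) (t, v) by split.
have Uq : U (t, x) by exact: (pUU (t, x) (t, v) Tt cq pUt).
split=> //.
have nq : ~ hyperplane i (f (t, x)) by move=> hq; apply: (pVV _ _ Uq cq pVt).
have V'q : V' (t, x) by split.
set w := vpick (val (f (t, x))).
have wq : hcoords (f (t, x)) w by exact: vpick_hcoords.
have wi := not_hyperplane nq wq.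
have rq j := let: And5 _ _ _ _ h := rP j in h (t, x) (t, v) V'q cq (pt j isT).
pose c := \prod_j (spec t (r j).1.2).@[v 0].
have c0 : c != 0 by apply/prodf_neq0 => j _; case: (rq j).
(* With [c] the product of the denominators, the [j]-th entry is [c] times the [j]-th affine
   coordinate [w 0 j / w 0 i]. *)
have -> : \row_j (spec t ((r j).1.1.2 * \prod_(k | k != j) (r k).1.2)).@[v 0] =
    (c / w 0 i) *: w.
  apply/rowP => j; rewrite !mxE !rmorphM !rmorph_prod /=.
  have [cj Ej] := rq j.
  rewrite -mulrA (mulrC (w 0 i)^-1) [w 0 j / _]Ej.
  rewrite [c](bigD1 j) //= mulrC.
  apply: (mulIf cj); rewrite -[RHS]mulrA divfK //.
  by rewrite mulrAC (mulrC _ (feval _ _)).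
have [wq1 w0] := wq.
by split; [exact: memvZ|rewrite scaler_eq0 negb_or w0 mulf_neq0 ?invr_eq0].
Qed.

End LocalRepresentation.

(** * Linear systems depending polynomially on a parameter *)

Section LinearFamilies.
Variables (K : fieldType) (m N : nat) (T : set (affine K m)).
Variable Sol : 'rV[K]_m -> set 'cV[K]_N.

(** [Sol t] is an arbitrary set of vectors; the rows of [M] are linear equations, polynomial in [t],
    that it satisfies over a principal neighbourhood of [t0]. *)
Definition vanishes_near (t0 : 'rV[K]_m) r (M : 'M[{mpoly K[m]}]_(r, N)) :
    Prop :=
  exists2 q : {mpoly K[m]}, q.@[t0 0] != 0 &
    forall (t : 'rV[K]_m) c, T t -> q.@[t 0] != 0 -> Sol t c ->
      map_mx (meval (t 0)) M *m c = 0.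

Lemma vanishes_near_col_mx (t0 : 'rV[K]_m) r s (M : 'M_(r, N)) (L : 'M_(s, N)) :
  vanishes_near t0 M -> vanishes_near t0 L -> vanishes_near t0 (col_mx M L).
Proof.
move=> [p p0 pM] [q q0 qL]; exists (p * q); first by rewrite mevalM mulf_neq0.
move=> t c Tt; rewrite mevalM mulf_eq0 negb_or => /andP[pt qt] ct.
by rewrite map_col_mx mul_col_mx (pM t) // (qL t) // col_mx0.
Qed.

(** The row [R] does not kill [c], whereas every row in the span of [M] does. *)
Lemma row_free_col_mx r (M : 'M[K]_(r, N)) (R : 'rV[K]_N) (c : 'cV[K]_N) :
  row_free M -> M *m c = 0 -> R *m c != 0 -> row_free (col_mx R M).
Proof.
move=> Mfree Mc Rc; rewrite -row_leq_rank -addsmxE.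
rewrite add1n -{1}(eqP Mfree); apply: rank_ltmx.
rewrite ltmxE addsmxSr /=; apply: contraNN Rc => /(submx_trans (addsmxSl R M)).
by move=> /submxP[X ->]; rewrite -mulmxA Mc mulmx0.
Qed.

(* Each point without solutions has a neighbourhood, cut out by a determinant,
   on which the linear system has no nonzero solution. *)
Lemma solvable_closed :
  (forall (t0 : 'rV[K]_m) c, T t0 -> ~ Sol t0 c ->
    exists R : 'rV[{mpoly K[m]}]_N,
      vanishes_near t0 R /\ map_mx (meval (t0 0)) R *m c != 0) ->
  closed_in T [set t | T t /\ exists2 c, c != 0 & Sol t c].
Proof.
move=> solP.
set Z : set (affine K m) := [set t | T t /\ exists2 c, c != 0 & Sol t c].
(* This is the Zariski closure of [Z]; it remains to see that it adds no point of [T]. *)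
exists [set t : affine K m | forall p : {mpoly K[m]},
    (forall t', Z t' -> p.@[t' 0] = 0) -> p.@[t 0] = 0].
  exists [set p : {mpoly K[m]} | forall t', Z t' -> p.@[t' 0] = 0].
  split=> [p _|]; first by exists 0%N.
  by apply/seteqP; split=> t /= tZ => [p pZ _ ->|p pZ]; exact: tZ.
apply/seteqP; split=> [t Zt|t0 [Tt0 Zt0]].
  by split=> [|p]; [case: Zt|exact].
apply: contrapT => nZ.
have solN c : c != 0 -> ~ Sol t0 c.
  by move=> c0 sc; apply: nZ; split=> //; exists c.
(* Independent equations are collected one at a time. As long as [r < N], the system at [t0] has a
   nonzero kernel vector; it is not in [Sol t0], so some further equation excludes it. *)
have rowsP r : (r <= N)%N -> exists M : 'M[{mpoly K[m]}]_(r, N),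
    vanishes_near t0 M /\ row_free (map_mx (meval (t0 0)) M).
  elim: r => [_|r IH rN].
    exists 0; split; last by rewrite -row_leq_rank.
    exists 1; first by rewrite meval1 oner_eq0.
    by move=> t c _ _ _; apply/matrixP => -[].
  have [M [Mann Mfree]] := IH (ltnW rN); set M0 := map_mx _ M in Mfree.
  have : cokermx M0 != 0.
    by rewrite -mxrank_eq0 mxrank_coker (eqP Mfree) -lt0n subn_gt0.
  move=> /matrix0Pn[i [j cij]]; pose c := col j (cokermx M0).
  have c0 : c != 0 by apply: contraNneq cij => /colP/(_ i); rewrite !mxE => ->.
  have Mc : M0 *m c = 0 by rewrite /c colE mulmxA mulmx_coker mul0mx.
  have [R [Rann Rc]] := solP t0 c Tt0 (solN c c0).
  exists (col_mx R M); split; first exact: (vanishes_near_col_mx Rann Mann).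
  by have := row_free_col_mx Mfree Mc Rc; rewrite -map_col_mx.
have [M [[q q0 qM]]] := rowsP N (leqnn N).
rewrite row_free_unit unitmxE unitfE det_map_mx => M0.
(* Where [q * \det M] is nonzero, an invertible system kills every solution. Hence this polynomial
   vanishes on [Z], and so at the point [t0] of its closure. *)
have /eqP : (q * \det M).@[t0 0] = 0.
  apply: Zt0 => t [Tt [c c0 tc]]; apply/eqP; rewrite mevalM mulf_eq0.
  apply: contraNT c0; rewrite negb_or => /andP[qt Mt].
  have Mu : map_mx (meval (t 0)) M \in unitmx.
    by rewrite unitmxE unitfE det_map_mx.
  by rewrite -(mulKmx Mu c) (qM t) // mulmx0.
by rewrite mevalM mulf_eq0 (negPf q0) (negPf M0).
Qed.

End LinearFamilies.

(** * Tuples of forms as coefficient vectors, and the proportionality equations *)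

Section FormTuples.
Variables (K : fieldType) (n d : nat).

(** Indexes the monomial basis of the tuples of [n.+1] forms of degree [d]; the bound [d.+1] makes
    it a finite type. *)
Definition tuple_monomial :=
  ('I_n.+1 * {mm : 'X_{1..n.+1 < d.+1} | mdeg mm == d})%type.

Local Notation N := #|{: tuple_monomial}|.

Definition form_tuple (c : 'cV[K]_N) (i : 'I_n.+1) : {mpoly K[n.+1]} :=
  \sum_(mm : {mm : 'X_{1..n.+1 < d.+1} | mdeg mm == d})
    c (enum_rank ((i, mm) : tuple_monomial)) 0 *: 'X_[val mm].

Lemma form_tuple_homog c i : form_tuple c i \is d.-homog.
Proof.
apply: rpred_sum => mm _; apply: rpredZ; rewrite dhomogX /=.
exact: (valP mm).
Qed.

Lemma mcoeff_form_tuple c i (mm : {mm : 'X_{1..n.+1 < d.+1} | mdeg mm == d}) :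
  (form_tuple c i)@_(val mm) = c (enum_rank ((i, mm) : tuple_monomial)) 0.
Proof.
rewrite /form_tuple raddf_sum (bigD1 mm) //= mcoeffZ mcoeffX eqxx mulr1.
rewrite big1 ?addr0 // => k km; rewrite mcoeffZ mcoeffX.
by rewrite (inj_eq val_inj) (inj_eq val_inj) (negPf km) mulr0.
Qed.

Lemma form_tuple_neq0 c : c != 0 -> exists i, form_tuple c i != 0.
Proof.
move=> /matrix0Pn[l [j]]; rewrite (ord1 j) -(enum_valK l).
case: (enum_val l) => i mm cl; exists i.
by apply: contraNneq cl => F0; rewrite -mcoeff_form_tuple F0 mcoeff0.
Qed.

Lemma form_tuple_onto (F : 'I_n.+1 -> {mpoly K[n.+1]}) :
  (forall i, F i \is d.-homog) -> exists c, form_tuple c =1 F.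
Proof.
move=> Fd.
exists (\col_(l < N) let p : tuple_monomial := enum_val l in
  (F p.1)@_(val p.2)) => i.
apply/mpolyP => mm; have [mmd|mmd] := eqVneq (mdeg mm) d; last first.
  rewrite (dhomog_nemf_coeff (form_tuple_homog _ i)) //.
  by rewrite (dhomog_nemf_coeff (Fd i)).
have mlt : (mdeg mm < d.+1)%N by rewrite mmd.
pose mm' : {mm : 'X_{1..n.+1 < d.+1} | mdeg mm == d} :=
  exist (fun mm : 'X_{1..n.+1 < d.+1} => mdeg mm == d) (BMultinom mlt)
    (introT eqP mmd).
by rewrite -[mm]/(val mm' : 'X_{1..n.+1}) mcoeff_form_tuple mxE enum_rankK.
Qed.

End FormTuples.

(** Collapses the sum over all basis indices in a product with [cross_row] to the two components
    involved. *)
Lemma sum_delta_sub (R : nzRingType) (I J : finType) (i j : I) (a b : R)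
    (x : I -> J -> R) :
  \sum_k \sum_l ((k == j)%:R * a - (k == i)%:R * b) * x k l =
  a * (\sum_l x j l) - b * (\sum_l x i l).
Proof.
have delta k c (y : I -> R) : \sum_l (l == k)%:R * c * y l = c * y k.
  rewrite (bigD1 k) //= eqxx mul1r big1 ?addr0 // => l /negPf ->.
  by rewrite !mul0r.
rewrite -(delta j a (fun k => \sum_l x k l)).
rewrite -(delta i b (fun k => \sum_l x k l)) -sumrB; apply: eq_bigr => k _.
by rewrite -mulrBl mulr_sumr.
Qed.

Section CrossRow.
Variables (K : fieldType) (m n d : nat).
Variables (A : 'I_n.+1 -> {mpoly {mpoly K[m]}[n.+1]}) (v : 'I_n.+1 -> K).
Local Notation N := #|{: tuple_monomial n d}|.

(** The linear form taking the coefficients of a tuple [F] to the value of [A i * F j - A j * F i]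
    at [v], with coefficients polynomial in the parameter. *)
Definition cross_row (i j : 'I_n.+1) : 'rV[{mpoly K[m]}]_N :=
  \row_(l < N) let p : tuple_monomial n d := enum_val l in
    ('X_[val p.2] : {mpoly K[n.+1]}).@[v] *:
      ((p.1 == j)%:R * eval_second v (A i) -
       (p.1 == i)%:R * eval_second v (A j)).

Lemma cross_rowE (t : 'rV[K]_m) (c : 'cV[K]_N) i j :
  (map_mx (meval (t 0)) (cross_row i j) *m c) 0 0 =
  (spec t (A i) * form_tuple c j - spec t (A j) * form_tuple c i).@[v].
Proof.
have evalF k : (form_tuple c k).@[v] =
    \sum_(mm : {mm : 'X_{1..n.+1 < d.+1} | mdeg mm == d})
      c (enum_rank ((k, mm) : tuple_monomial n d)) 0 *
      ('X_[val mm] : {mpoly K[n.+1]}).@[v].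
  by rewrite /form_tuple raddf_sum; apply: eq_bigr => mm _ /=; rewrite mevalZ.
rewrite mevalB !mevalM -!eval_secondE !evalF.
rewrite -(sum_delta_sub i j _ _
  (fun k (mm : {mm : 'X_{1..n.+1 < d.+1} | mdeg mm == d}) =>
  c (enum_rank ((k, mm) : tuple_monomial n d)) 0 *
  ('X_[val mm] : {mpoly K[n.+1]}).@[v])).
rewrite mxE (reindex (@enum_rank (tuple_monomial n d))) /=; last first.
  exact/onW_bij/enum_rank_bij.
rewrite pair_bigA /=; apply: eq_bigr => -[k mm] _; rewrite !mxE enum_rankK /=.
rewrite mevalZ mevalB !mevalM !rmorph_nat.
by rewrite -mulrA [LHS]mulrC -mulrA.
Qed.

End CrossRow.

(** * Semicontinuity and boundedness of the degree *)

Section BirMorphism.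
Variables (K : closedFieldType) (m n : nat) (T : set (affine K m)).
Variable phi : affine K m -> Bir [set: proj K n].
Hypothesis phi_mor : bir_morphism T phi.

(** Density of [U] in the fibre over [t0] supplies a point around which the family is expressed by
    forms. The family [f] may replace [phi] because equivalent rational maps have the same
    representing tuples. *)
Lemma local_family : exists f : 'rV[K]_m -> line K n -> line K n,
  (forall t, T t -> forall F, represents (phi t) F <-> represents (f t) F) /\
  forall t0, T t0 ->
    exists (b : {mpoly {mpoly K[m]}[n.+1]})
      (F : 'I_n.+1 -> {mpoly {mpoly K[m]}[n.+1]}) d,
    [/\ spec t0 b != 0, forall i, F i \is d.-homog &
      forall t, T t -> spec t b != 0 ->
        represents (f t) (fun i => spec t (F i)) /\
        exists i, spec t (F i) != 0].
Proof.
have [Phi [U [f [[_ [[Uo _] _] Ud fU _] phiP]]]] := phi_mor.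
exists (fun t x => f (t, x)); split=> [t Tt F|t0 Tt0].
  have [g [_ gf [W [Wd _ Wg]]]] := phiP t Tt; split.
    by apply: (represents_eq_on Wd) => x /Wg ->; rewrite gf.
  by apply: (represents_eq_on Wd) => x /Wg ->; rewrite gf.
have [x0 Ux0] : exists x0, U (t0, x0).
  have [||q [_ [Uq qt0]]] := (Ud t0 Tt0).2 (fiber t0).
  - by exists set0; [exact: zclosed_set0_affine_proj|rewrite setD0].
  - have /mpoly_nonroot_neq0[v v0 _] := oner_neq0 {mpoly K[n.+1]}.
    by have [x] := hcoords_ex v0; exists (t0, x).
  by exists q.2; rewrite -qt0 -surjective_pairing.
have [b [F [d [[e be] Fd b0 bF]]]] := local_representation Uo fU Ux0.
exists b, F, d; split=> // t Tt bt; split.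
  exists (spec t b); split=> // [|x v vx bv].
    by exists e; exact: spec_homog.
  by have [_ []] := bF t x v Tt vx bv.
have [v v0 bv] := mpoly_nonroot_neq0 bt; have [x vx] := hcoords_ex v0.
have [_ [_ Fv]] := bF t x v Tt vx bv.
apply: contrapT => F0; move/negP: Fv; apply; apply/eqP/rowP => i; rewrite !mxE.
suff -> : spec t (F i) = 0 by rewrite meval0.
by apply/eqP/negPn/negP => Fi; apply: F0; exists i.
Qed.

Lemma represented_phi t : T t -> exists e, represented_in_degree (phi t) e.
Proof.
have [f [fphi fP]] := local_family.
move=> Tt; have [b [F [d [b0 Fd bF]]]] := fP t Tt.
have [Fr Fi] := bF t Tt b0; exists d, (fun i => spec t (F i)); split=> //.
  by move=> i; exact: spec_homog.
exact/fphi.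
Qed.

Lemma deg_leq_closed d : closed_in T [set t | T t /\ (deg (phi t) <= d)%N].
Proof.
have [f [fphi fP]] := local_family.
have -> : [set t | T t /\ (deg (phi t) <= d)%N] =
    [set t | T t /\ exists2 c, c != 0 & represents (f t) (@form_tuple K n d c)].
  apply/seteqP; split=> t [Tt]; have [e /(deg_leq d) dE] := represented_phi Tt.
    move=> /dE[F [Fd [i Fi] /(fphi t Tt) Fr]]; split=> //.
    have [c cF] := form_tuple_onto Fd; exists c.
      apply: contraNneq Fi => c0; rewrite -cF c0 /form_tuple big1 // => mm _.
      by rewrite mxE scale0r.
    by have -> : form_tuple c = F by exact/funext.
  move=> [c c0 /(fphi t Tt) cr]; split=> //; apply/dE; exists (form_tuple c).
  by split=> //; [move=> i; exact: form_tuple_homog|exact: form_tuple_neq0].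
apply: solvable_closed => t0 c Tt0 nrep.
have [b [F [e [b0 Fe bF]]]] := fP t0 Tt0.
have [Fr [i Fi]] := bF t0 Tt0 b0.
(* Since [F i] is nonzero at [t0], a tuple satisfying all proportionality relations with index [i]
   would represent [f t0]. *)
have [j nij] : exists j,
    spec t0 (F i) * form_tuple c j != spec t0 (F j) * form_tuple c i.
  apply: contrapT => eqF; apply: nrep.
  apply: proportional_represents Fr Fi (spec_homog _ (Fe i)) _ => j.
  by apply/eqP/negPn/negP => nij; apply: eqF; exists j.
rewrite -subr_eq0 in nij.
(* The same [v] detects the violated relation and keeps [b] nonzero; [b] evaluated at [v] then cuts
   out the neighbourhood of [t0] on which the equation holds for all solutions. *)
have [v] := mpoly_nonroot (mulf_neq0 b0 nij).
rewrite mevalM mulf_eq0 negb_or => /andP[bv Dv].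
exists (cross_row d F v i j); split; last first.
  by apply: contraNneq Dv => Rc; rewrite -cross_rowE Rc mxE.
exists (eval_second v b); first by rewrite eval_secondE.
move=> t c' Tt; rewrite eval_secondE => bt c'r.
have b't : spec t b != 0 by apply: contraNneq bt => ->; rewrite meval0.
have [Frt _] := bF t Tt b't.
apply/matrixP => x y; rewrite (ord1 x) (ord1 y) cross_rowE.
by rewrite (represents_proportional Frt c'r) subrr meval0 mxE.
Qed.

(** [T] is the union of the closed sets where the degree is at most [e] and where [b] vanishes at
    [v]. The second omits [t0], so the first is all of [T]. *)
Lemma deg_bounded : irreducible T ->
  exists e, forall t, T t -> (deg (phi t) <= e)%N.
Proof.
move=> [[t0 Tt0] Tirr].
have [f [fphi fP]] := local_family.
have [b [F [e [b0 Fe bF]]]] := fP t0 Tt0; exists e.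
have [v bv] := mpoly_nonroot b0.
pose C : set (affine K m) := [set t | T t /\ (eval_second v b).@[t 0] = 0].
have Cc : closed_in T C.
  exists [set t : affine K m | (eval_second v b).@[t 0] = 0] => //.
  exists [set eval_second v b]; split=> [_ ->|]; first by exists 0%N.
  by apply/seteqP; split=> t /= tb => [_ -> _ ->|]; [|exact: tb].
have [|TZ|TC] := Tirr _ C (deg_leq_closed e) Cc.
- apply/seteqP; split=> [t Tt|t [[]|[]]//].
  have [bt|/eqP bt] := eqVneq ((eval_second v b).@[t 0]) 0; first by right.
  left; split=> //; have [e' /(deg_leq e) dE] := represented_phi Tt; apply/dE.
  have [|Fr Fi] := bF t Tt.
    by apply: contra_not_neq bt => bt; rewrite eval_secondE bt meval0.
  exists (fun i => spec t (F i)); split=> //; last exact/fphi.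
  by move=> i; exact: spec_homog.
- by move=> t; rewrite {1}TZ => -[].
move: Tt0; rewrite TC => -[_]; rewrite eval_secondE => /eqP.
by rewrite (negPf bv).
Qed.

End BirMorphism.

Theorem theorem28 (K : closedFieldType) (m n : nat) (T : set (affine K m))
    (phi : affine K m -> Bir [set: proj K n])
    (T_closed : zclosed T) (T_irr : irreducible T)
    (phi_mor : bir_morphism T phi) :
  (exists (l : nat) (V : 'I_l -> set (affine K m)),
     [/\ forall j, locally_closed_in T (V j),
         trivIset setT V,
         T = \bigcup_j V j &
         forall j, exists d : nat, forall t, V j t -> deg (phi t) = d]) /\
  (forall d : nat, closed_in T [set t | T t /\ (deg (phi t) <= d)%N]).
Proof.
split; last exact: deg_leq_closed.
have [e degT] := deg_bounded phi_mor T_irr.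
(* One stratum, possibly empty, for each degree from 0 to [e]: the closed set of degree at most [j]
   minus the closed set of degree less than [j]. *)
exists e.+1, (fun j => [set t | T t /\ deg (phi t) = j]); split.
- move=> j; have [D Dc DE] : closed_in T [set t | T t /\ (deg (phi t) < j)%N].
    case: (nat_of_ord j) => [|k]; last exact: deg_leq_closed.
    suff -> : [set t | T t /\ (deg (phi t) < 0)%N] = set0.
      by exists set0; [exact: zclosed_set0_affine|rewrite setI0].
    by apply/seteqP; split=> t []; rewrite ?ltn0.
  exists [set t | T t /\ (deg (phi t) <= j)%N], (T `\` D); split.
  + exact: deg_leq_closed.
  + by exists D.
  have TD t : T t -> D t <-> (deg (phi t) < j)%N.
    move=> Tt; split=> [Dt|tj].
      by have : (T `&` D) t by []; rewrite -DE => -[].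
    by have [] : (T `&` D) t by rewrite -DE.
  apply/seteqP; split=> t.
    move=> [Tt tj]; rewrite /= tj; split=> //.
    by split=> // /(TD t Tt); rewrite tj ltnn.
  move=> [[Tt tj] [_ nD]]; split=> //; apply/eqP; rewrite eqn_leq tj leqNgt.
  by apply/negP => /(TD t Tt).
- by move=> i j _ _ [t [[_ ti] [_ tj]]]; apply/val_inj; rewrite /= -ti.
- apply/seteqP; split=> [t Tt|t [j _ []//]].
  have tj : (deg (phi t) < e.+1)%N by exact: degT.
  by exists (Ordinal tj).
by move=> j; exists j => t [].
Qed.
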